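(* Let $K$ be a nonnegative integer, let $N$ be a squarefree positive integer having at most $K$ prime divisors, and let $\Sigma=\{(t,t^2):t\in\mathbb{Z}/N\mathbb{Z}\}\subset(\mathbb{Z}/N\mathbb{Z})^2$. Then for every $f:(\mathbb{Z}/N\mathbb{Z})^2\to\mathbb{C}$, $$\left(\frac{1}{|\Sigma|}\sum_{m\in\Sigma}|\widehat{f}(m)|^2\right)^{\frac12}\leq 2^{\frac{K}{4}}\cdot N^{-1}\left(\sum_{x\in(\mathbb{Z}/N\mathbb{Z})^2}|f(x)|^{\frac43}\right)^{\frac34}.$$ In particular, whenever $N=pq$ with $p$ and $q$ distinct primes, for every $f:(\mathbb{Z}/N\mathbb{Z})^2\to\mathbb{C}$, $$\left(\frac{1}{|\Sigma|}\sum_{m\in\Sigma}|\widehat{f}(m)|^2\right)^{\frac12}\leq \sqrt{2}\cdot N^{-1}\left(\sum_{x\in(\mathbb{Z}/N\mathbb{Z})^2}|f(x)|^{\frac43}\right)^{\frac34}.$$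
   Context: The Fourier transform of $f:(\mathbb{Z}/N\mathbb{Z})^2\to\mathbb{C}$ is normalized by $\widehat{f}(m)=N^{-1}\sum_{x\in(\mathbb{Z}/N\mathbb{Z})^2}f(x)e^{-2\pi i x\cdot m/N}$ for $m\in(\mathbb{Z}/N\mathbb{Z})^2$, where $x\cdot m=x_1m_1+x_2m_2$. *)

(* Defs.v *)
From mathcomp Require Import all_boot all_order all_algebra.
From mathcomp Require Import all_classical all_reals all_analysis.
From mathcomp Require Export complex.

Set Implicit Arguments.
Unset Strict Implicit.
Unset Printing Implicit Defensive.

Import Order.TTheory GRing.Theory Num.Theory.

Local Open Scope ring_scope.
Local Open Scope complex_scope.

(* For N > 0 this is Z/NZ, including N = 1, where 'Z_N would be Z/2Z.
   Zp_add, Zp_mul and inZp apply to it for every N > 0. *)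
Notation Zmod N := 'I_N.-1.+1.

Definition squarefree (N : nat) : Prop :=
  forall d : nat, (d ^ 2 %| N)%N -> d = 1%N.

Definition parabola (N : nat) : {set Zmod N * Zmod N} :=
  [set (t, Zp_mul t t) | t : Zmod N].

Section Fourier.
Variable R : realType.

(* e^{i theta} *)
Definition cis (theta : R) : R[i] := cos theta +i* sin theta.

(* The modulus as an element of R: the norm `|z| lives in R[i]. *)
Definition cmod (z : R[i]) : R := ComplexField.Normc.normc z.

(* x.m is computed on representatives in {0, ..., N-1}; the exponential only
   depends on its residue modulo N. *)
Definition fourier (N : nat) (f : Zmod N * Zmod N -> R[i])
    (m : Zmod N * Zmod N) : R[i] :=
  (N%:R)^-1 * \sum_(x : Zmod N * Zmod N)
    f x * cis (- (2 * pi * (x.1 * m.1 + x.2 * m.2)%N%:R / N%:R)).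

End Fourier.

(* Main.v *)
(** By duality with the extension operator
    [E g x = \sum_t g t * e (x . (t, t^2))], the bound is equivalent to an
    L^2 -> L^4 estimate for [E]. Since [(E g)^2] is the transform of the
    convolution of [g] with itself on the parabola, Parseval and Cauchy-Schwarz
    reduce that estimate to bounding the number of pairs [(s, t)] with
    prescribed [s + t] and [s^2 + t^2]. Modulo each prime divisor of [N], [s]
    takes at most two values, so for squarefree [N] there are at most [2 ^ K]
    such pairs. *)

Require Import Defs.
From mathcomp Require Import all_boot all_order all_algebra.
From mathcomp Require Import all_classical all_reals all_analysis.
From mathcomp Require Import ring lra zify.

Set Implicit Arguments.
Unset Strict Implicit.
Unset Printing Implicit Defensive.

Import Order.TTheory GRing.Theory Num.Theory.

Local Open Scope ring_scope.

(** * Cauchy-Schwarz and Hölder for finite sums *)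

(** Lagrange's identity: twice the difference of the two sides is a double sum of squares. The
    entries are real elements of [C] because the moduli fed to it later live in the complex
    field. *)
Lemma cauchy_schwarz_sum (C : numFieldType) (I : finType) (P : pred I)
    (a b : I -> C) :
  (forall i, a i \is Num.real) -> (forall i, b i \is Num.real) ->
  (\sum_(i | P i) a i * b i) ^+ 2
    <= (\sum_(i | P i) a i ^+ 2) * (\sum_(i | P i) b i ^+ 2).
Proof.
move=> ra rb.
have lagrange : 0 <= \sum_(i | P i) \sum_(j | P j) (a i * b j - a j * b i) ^+ 2.
  apply: sumr_ge0 => i _; apply: sumr_ge0 => j _.
  by rewrite real_exprn_even_ge0 ?rpredB ?rpredM.
have expand : \sum_(i | P i) \sum_(j | P j) (a i * b j - a j * b i) ^+ 2
   = 2 * ((\sum_(i | P i) a i ^+ 2) * (\sum_(i | P i) b i ^+ 2)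
          - (\sum_(i | P i) a i * b i) ^+ 2).
  transitivity (\sum_(i | P i) \sum_(j | P j)
      (a i ^+ 2 * b j ^+ 2 + (b i ^+ 2 * a j ^+ 2
       + - 2 * ((a i * b i) * (a j * b j))))).
    by apply: eq_bigr => i _; apply: eq_bigr => j _; ring.
  under eq_bigr do rewrite !big_split /= -!mulr_sumr.
  by rewrite !big_split /= -!mulr_suml -mulr_sumr -mulr_suml; ring.
by rewrite expand pmulr_rge0 ?ltr0n // subr_ge0 in lagrange.
Qed.

(* Two Cauchy-Schwarz steps, starting from [a^3 b = a^2 * (a b)]. *)
Lemma holder_sum34 (C : numFieldType) (I : finType) (a b : I -> C) :
  (forall i, a i \is Num.real) -> (forall i, b i \is Num.real) ->
  (\sum_i a i ^+ 3 * b i) ^+ 4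
    <= (\sum_i a i ^+ 4) ^+ 3 * \sum_i b i ^+ 4.
Proof.
move=> ra rb.
have real_sum (F : I -> C) : (forall i, F i \is Num.real) -> \sum_i F i \is Num.real.
  by move=> rF; apply: rpred_sum.
have ge4 (F : I -> C) : (forall i, F i \is Num.real) -> 0 <= \sum_i F i ^+ 4.
  by move=> rF; apply: sumr_ge0 => i _; rewrite real_exprn_even_ge0.
have CS1 : (\sum_i a i ^+ 3 * b i) ^+ 2
    <= (\sum_i a i ^+ 4) * \sum_i (a i * b i) ^+ 2.
  have := @cauchy_schwarz_sum C I predT (fun i => a i ^+ 2) (fun i => a i * b i).
  under eq_bigr do rewrite mulrA -exprSr.
  under [X in _ <= X * _]eq_bigr do rewrite -exprM.
  by apply => i; rewrite ?rpredX ?rpredM.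
have CS2 : (\sum_i (a i * b i) ^+ 2) ^+ 2
    <= (\sum_i a i ^+ 4) * \sum_i b i ^+ 4.
  have := @cauchy_schwarz_sum C I predT (fun i => a i ^+ 2) (fun i => b i ^+ 2).
  under eq_bigr do rewrite -exprMn.
  under [X in _ <= X * _]eq_bigr do rewrite -exprM.
  under [X in _ <= _ * X]eq_bigr do rewrite -exprM.
  by apply => i; rewrite rpredX.
rewrite -[4%N]/(2 * 2)%N exprM.
apply: (@le_trans _ _ (((\sum_i a i ^+ 4) * \sum_i (a i * b i) ^+ 2) ^+ 2)).
  rewrite lerXn2r ?nnegrE // ?real_exprn_even_ge0 //.
    by apply: real_sum => i; rewrite rpredM ?rpredX.
  by rewrite mulr_ge0 ?ge4 // sumr_ge0 // => i _; rewrite real_exprn_even_ge0 ?rpredM.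
rewrite exprMn [X in _ <= X * _]exprSr -[X in _ <= X]mulrA; apply: ler_wpM2l => //.
by rewrite exprn_ge0 ?ge4.
Qed.

(** * Orthogonality of characters and Parseval *)

Lemma norm_prim_root (C : numClosedFieldType) n (w : C) :
  (0 < n)%N -> n.-primitive_root w -> `|w| = 1.
Proof.
move=> n_gt0 /prim_expr_order wn; apply/eqP.
by rewrite -(@pexpr_eq1 _ _ n) // -normrX wn normr1.
Qed.

(** The summand is [z ^+ x] for the root of unity z = w^(i-j). Either z = 1, or the geometric sum is
    killed by the nonzero factor z - 1. *)
Lemma sum_geom_prim_root (C : numClosedFieldType) n (w : C) (i j : 'I_n) :
  n.-primitive_root w ->
  \sum_(x < n) w ^+ (x * i) * (w ^+ (x * j))^* = n%:R * (i == j)%:R.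
Proof.
move=> hw; have n_gt0 : (0 < n)%N by apply: leq_ltn_trans (ltn_ord i).
have nw := norm_prim_root n_gt0 hw.
have ww : w * w^* = 1 by rewrite -normCK nw expr1n.
pose z := w ^+ i * (w^* ) ^+ j.
have -> : \sum_(x < n) w ^+ (x * i) * (w ^+ (x * j))^* = \sum_(x < n) z ^+ x.
  by apply: eq_bigr => x _; rewrite exprMn -!exprM rmorphXn ![(x * _)%N]mulnC.
have zj : z * w ^+ j = w ^+ i.
  by rewrite -mulrA -exprMn [_ * w]mulrC ww expr1n mulr1.
have zn : z ^+ n = 1.
  rewrite exprMn -!exprM ![(_ * n)%N]mulnC !exprM -rmorphXn.
  by rewrite (prim_expr_order hw) rmorph1 !expr1n mulr1.
have w0 : w ^+ j != 0 by rewrite expf_neq0 // -normr_eq0 nw oner_eq0.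
case: (eqVneq i j) zj => [->|ij] zj /=.
  have -> : z = 1 by apply: (mulIf w0); rewrite zj mul1r.
  under eq_bigr do rewrite expr1n.
  by rewrite sumr_const card_ord mulr1.
have z1 : z - 1 != 0.
  rewrite subr_eq0; apply: contraNneq ij => z1; move: zj; rewrite z1 mul1r.
  move/eqP; rewrite (eq_prim_root_expr hw) !modn_small // => /eqP ji.
  by apply/eqP/val_inj.
by apply: (mulfI z1); rewrite -subrX1 zn subrr !mulr0.
Qed.

Notation chi w x m := (w ^+ (x.1 * m.1 + x.2 * m.2)).

(** Expanding the square leaves correlations of two characters, which factor over the coordinates of
    [x]. Distinct [m] and [m'] differ in some coordinate, and the factor of that coordinate
    vanishes. *)
Lemma parseval (C : numClosedFieldType) n (w : C) (h : 'I_n * 'I_n -> C) :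
  n.-primitive_root w ->
  \sum_(x : 'I_n * 'I_n) `|\sum_m h m * chi w x m| ^+ 2
    = n%:R ^+ 2 * \sum_m `|h m| ^+ 2.
Proof.
move=> hw.
under eq_bigr do rewrite normCK rmorph_sum big_distrlr /=.
rewrite exchange_big mulr_sumr /=; apply: eq_bigr => m _.
rewrite exchange_big /= (bigD1 m) //= [X in _ + X]big1 => [|m' m'm].
  under eq_bigr do rewrite !rmorphM /= mulrACA -normCK.
  rewrite -mulr_sumr addr0 mulrC; congr (_ * _).
  rewrite -(pair_bigA _ (fun x y : 'I_n => chi w (x, y) m * (chi w (x, y) m)^*)) /=.
  under eq_bigr do under eq_bigr do rewrite !exprD rmorphM mulrACA.
  under eq_bigr do rewrite -mulr_sumr.
  by rewrite -mulr_suml !sum_geom_prim_root // !eqxx !mulr1.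
under eq_bigr do rewrite !rmorphM /= mulrACA.
rewrite -mulr_sumr.
rewrite -(pair_bigA _ (fun x y : 'I_n => chi w (x, y) m * (chi w (x, y) m')^*)) /=.
under eq_bigr do under eq_bigr do rewrite !exprD rmorphM mulrACA.
under eq_bigr do rewrite -mulr_sumr.
rewrite -mulr_suml !sum_geom_prim_root //.
have : ~~ ((m.1 == m'.1) && (m.2 == m'.2)) by rewrite -xpair_eqE -!surjective_pairing eq_sym.
by rewrite negb_and => /orP[] /negPf ->; rewrite !(mulr0, mul0r).
Qed.

(** Addition of frequencies reduces modulo [n.+1], whereas [chi] computes its exponent in [nat]; the
    order of [w] absorbs the difference. *)
Lemma chiD (C : numClosedFieldType) n (w : C) (x m m' : 'I_n.+1 * 'I_n.+1) :
  n.+1.-primitive_root w -> chi w x (m + m') = chi w x m * chi w x m'.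
Proof.
move=> hw.
have wM (a b c : nat) : w ^+ (a * ((b + c) %% n.+1)) = w ^+ (a * b) * w ^+ (a * c).
  by rewrite -exprD -(prim_expr_mod hw) modnMmr (prim_expr_mod hw) mulnDr.
by rewrite !exprD !wM mulrACA.
Qed.

(** * Extension and restriction estimates for a general [gam] *)

(** The only information on [gam] that enters is [M], a bound on the number of ways to write a point
    as a sum of two values of [gam]. *)
Lemma extension_L4 (C : numClosedFieldType) n (w : C) (T : finType)
    (gam : T -> 'I_n.+1 * 'I_n.+1) (M : nat) (g : T -> C) :
  n.+1.-primitive_root w ->
  (forall m : 'I_n.+1 * 'I_n.+1, #|[pred u : T * T | (gam u.1 + gam u.2 == m)%R]| <= M)%N ->
  \sum_(x : 'I_n.+1 * 'I_n.+1) `|\sum_t g t * chi w x (gam t)| ^+ 4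
    <= n.+1%:R ^+ 2 * M%:R * (\sum_t `|g t| ^+ 2) ^+ 2.
Proof.
move=> hw hM.
pose h (m : 'I_n.+1 * 'I_n.+1) := \sum_(u : T * T | gam u.1 + gam u.2 == m) g u.1 * g u.2.
have sqE (x : 'I_n.+1 * 'I_n.+1) : (\sum_t g t * chi w x (gam t)) ^+ 2 = \sum_m h m * chi w x m.
  rewrite expr2 big_distrlr /=.
  rewrite (pair_bigA _ (fun s t => g s * chi w x (gam s) * (g t * chi w x (gam t)))) /=.
  rewrite (partition_big (fun u : T * T => gam u.1 + gam u.2) predT) //=.
  apply: eq_bigr => m _; rewrite mulr_suml; apply: eq_bigr => u /eqP <-.
  by rewrite mulrACA chiD.
under eq_bigr do rewrite -[4%N]/(2 * 2)%N exprM -normrX sqE.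
rewrite parseval // -mulrA; apply: ler_wpM2l; first by rewrite exprn_ge0.
have hb m : `|h m| ^+ 2 <=
    M%:R * \sum_(u : T * T | gam u.1 + gam u.2 == m) `|g u.1| ^+ 2 * `|g u.2| ^+ 2.
  (* The factor 1 is there for Cauchy-Schwarz: its squares add up to the size of the fibre over [m],
     at most [M]. *)
  apply: (@le_trans _ _ ((\sum_(u : T * T | gam u.1 + gam u.2 == m)
       1 * (`|g u.1| * `|g u.2|)) ^+ 2)).
    rewrite lerXn2r ?nnegrE //.
      by apply: sumr_ge0 => u _; rewrite mul1r mulr_ge0.
    apply: le_trans (ler_norm_sum _ _ _) _.
    by apply: ler_sum => u _; rewrite normrM mul1r.
  apply: le_trans (cauchy_schwarz_sum _ _ _) _ => [i|i|].
  - by rewrite rpred1.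
  - by rewrite rpredM ?normr_real.
  under [X in _ * X]eq_bigr do rewrite exprMn.
  apply: ler_wpM2r; first by apply: sumr_ge0 => u _; rewrite mulr_ge0 ?exprn_ge0.
  under eq_bigr do rewrite expr1n.
  by rewrite sumr_const ler_nat; apply: hM.
apply: le_trans (ler_sum _ (fun m _ => hb m)) _.
rewrite -mulr_sumr expr2 big_distrlr /=.
rewrite (pair_bigA _ (fun s t => `|g s| ^+ 2 * `|g t| ^+ 2)) /=.
by rewrite [X in _ <= _ * X](partition_big (fun u : T * T => gam u.1 + gam u.2) predT).
Qed.

(* The hypothesis [a x ^+ 3 = `|f x|] stands for [a = |f|^(1/3)]. *)
Lemma restriction_L43 (C : numClosedFieldType) n (w : C) (T : finType)
    (gam : T -> 'I_n.+1 * 'I_n.+1) (M : nat) (f a : 'I_n.+1 * 'I_n.+1 -> C)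
    (F : T -> C) :
  n.+1.-primitive_root w ->
  (forall m : 'I_n.+1 * 'I_n.+1, #|[pred u : T * T | (gam u.1 + gam u.2 == m)%R]| <= M)%N ->
  (forall x, a x \is Num.real) -> (forall x, a x ^+ 3 = `|f x|) ->
  (forall t, F t = n.+1%:R^-1 * \sum_x f x * chi w x (gam t)) ->
  (\sum_t `|F t| ^+ 2) ^+ 2 <= n.+1%:R^-1 ^+ 2 * M%:R * (\sum_x a x ^+ 4) ^+ 3.
Proof.
move=> hw hM ra aE FE; set S := \sum_t _.
(* Conjugating [F] and not the character makes [S] equal to 1/N times the bilinear pairing of [f]
   with the extension [G] of the conjugate of [F]. *)
pose G (x : 'I_n.+1 * 'I_n.+1) := \sum_t (F t)^* * chi w x (gam t).
have S_ge0 : 0 <= S by apply: sumr_ge0 => t _; rewrite exprn_ge0.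
have SE : S = n.+1%:R^-1 * \sum_x f x * G x.
  rewrite /S; under eq_bigr do rewrite normCKC [X in _ * X]FE mulrCA mulr_sumr.
  rewrite -mulr_sumr exchange_big /=; congr (_ * _); apply: eq_bigr => x _.
  by rewrite mulr_sumr; apply: eq_bigr => t _; rewrite mulrCA.
have A_ge0 : 0 <= \sum_x a x ^+ 4.
  by apply: sumr_ge0 => x _; rewrite real_exprn_even_ge0.
(* Hölder with exponents 4/3 and 4, then the extension estimate for [G], bring [S ^+ 2] back on the
   right; it is cancelled below once [S] is nonzero. *)
have S4 : S ^+ 4 <= n.+1%:R^-1 ^+ 4 * ((\sum_x a x ^+ 4) ^+ 3 *
     (n.+1%:R ^+ 2 * M%:R * S ^+ 2)).
  have le1 : S <= n.+1%:R^-1 * \sum_x a x ^+ 3 * `|G x|.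
    rewrite -(ger0_norm S_ge0) {1}SE normrM ger0_norm ?invr_ge0 //.
    apply: ler_wpM2l; first by rewrite invr_ge0.
    apply: le_trans (ler_norm_sum _ _ _) _.
    by apply: ler_sum => x _; rewrite normrM aE.
  apply: (@le_trans _ _ ((n.+1%:R^-1 * \sum_x a x ^+ 3 * `|G x|) ^+ 4)).
    by rewrite lerXn2r ?nnegrE // (le_trans S_ge0).
  rewrite exprMn; apply: ler_wpM2l; first by rewrite exprn_ge0 ?invr_ge0.
  apply: le_trans (holder_sum34 ra _) _ => [x|]; first exact: normr_real.
  apply: ler_wpM2l; first by rewrite exprn_ge0.
  have := @extension_L4 C n w T gam M (fun t => (F t)^*) hw hM.
  by under [X in _ * X ^+ 2]eq_bigr do rewrite norm_conjC.
case: (eqVneq S 0) => [->|S0].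
  by rewrite expr0n /= !mulr_ge0 ?exprn_ge0 ?invr_ge0.
have S2 : 0 < S ^+ 2 by rewrite exprn_gt0 // lt0r S0.
rewrite -(ler_pM2r S2) -exprD; apply: le_trans S4 _.
rewrite le_eqVlt; apply/orP; left; apply/eqP.
by field; rewrite nat1r pnatr_eq0.
Qed.

(** * Counting representations as a sum of two points of the parabola *)

(** The valuation of [N] at each of its primes is exactly 1, so divisibility by the primes already
    gives divisibility by all prime-power parts. *)
Lemma squarefree_dvdn (N d : nat) :
  (0 < N)%N -> squarefree N -> (forall p, p \in primes N -> p %| d)%N -> (N %| d)%N.
Proof.
move=> N_gt0 sqf pd; apply/(dvdn_partP d N_gt0) => p; rewrite inE /= => pN.
move: (pN); rewrite mem_primes => /and3P[p_pr _ _].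
rewrite p_part; have -> : logn p N = 1%N; last exact: pd.
apply/eqP; rewrite eqn_leq logn_gt0 pN andbT leqNgt -pfactor_dvdn //.
by apply/negP => /sqf p1; rewrite p1 in p_pr.
Qed.

(** Uniqueness in the Chinese remainder theorem. Differences are taken in [int] since subtraction in
    [nat] truncates. *)
Lemma primes_squarefree_inj (n : nat) (s s' : 'I_n.+1) :
  squarefree n.+1 -> (forall p, p \in primes n.+1 -> (p %| s%:Z - s'%:Z)%Z) -> s = s'.
Proof.
move=> sqf h; apply: val_inj => /=.
have : (n.+1%:Z %| s%:Z - s'%:Z)%Z.
  by rewrite dvdzE; apply: squarefree_dvdn => // p /h; rewrite dvdzE.
by rewrite -eqz_mod_dvd !modz_nat !modn_small // => /eqP[].
Qed.

(* Two representations [(s0, t0)], [(s, t)] of the same point satisfy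
   [2 (s - s0) (s - t0) = 0]; modulo 2 there is nothing to prove. *)
Lemma parabola_sum_prime (p : nat) (s t s0 t0 : int) :
  prime p -> p <> 2%N ->
  (p %| (s + t) - (s0 + t0))%Z -> (p %| (s * s + t * t) - (s0 * s0 + t0 * t0))%Z ->
  (p %| s - s0)%Z \/ (p %| s - t0)%Z.
Proof.
move=> p_pr p2 d1 d2.
have : (p %| 2 * ((s - s0) * (s - t0)))%Z.
  (* This eliminates t: with c = s0 + t0, the last product is (s - c)^2 - t^2, which cancels the t^2
     of the first term. *)
  have -> : 2 * ((s - s0) * (s - t0))
     = (s * s + t * t - (s0 * s0 + t0 * t0))
       + (s + t - (s0 + t0)) * (s - t - s0 - t0) by ring.
  by rewrite rpredD ?dvdz_mulr.
rewrite !dvdzE !abszM !Euclid_dvdM // => /or3P[|->|->]; [|by left|by right].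
by rewrite dvdn_prime2 // => /eqP.
Qed.

Definition parabola_point (n : nat) (t : 'I_n.+1) : 'I_n.+1 * 'I_n.+1 := (t, Zp_mul t t).

Lemma parabola_sum_eq (n : nat) (u v : 'I_n.+1 * 'I_n.+1) :
  parabola_point u.1 + parabola_point u.2 = parabola_point v.1 + parabola_point v.2 ->
  (n.+1 %| (u.1%:Z + u.2%:Z) - (v.1%:Z + v.2%:Z))%Z /\
  (n.+1 %| (u.1%:Z * u.1%:Z + u.2%:Z * u.2%:Z)
           - (v.1%:Z * v.1%:Z + v.2%:Z * v.2%:Z))%Z.
Proof.
move=> [e1 e2].
have eqz (a b : nat) : a = b %[mod n.+1] -> (n.+1 %| a%:Z - b%:Z)%Z.
  by move=> ab; rewrite -eqz_mod_dvd !modz_nat ab.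
split; first exact: (eqz (u.1 + u.2)%N (v.1 + v.2)%N).
apply: (eqz (u.1 * u.1 + u.2 * u.2)%N (v.1 * v.1 + v.2 * v.2)%N).
by move: e2; rewrite /= !modnDml !modnDmr.
Qed.

(* Fix one representation [(s0, t0)] of [m]: another one [(s, t)] is determined by
   the set of primes [p] dividing [N] with [s = s0] modulo [p]. *)
Lemma card_parabola_sum (n K : nat) (m : 'I_n.+1 * 'I_n.+1) :
  squarefree n.+1 -> (size (primes n.+1) <= K)%N ->
  (#|[pred u : 'I_n.+1 * 'I_n.+1 |
       (parabola_point u.1 + parabola_point u.2 == m)%R]| <= 2 ^ K)%N.
Proof.
move=> sqf hK; set A := [pred u | _].
case: (pickP A) => [v /eqP Av|A0]; last by rewrite eq_card0.
set P := primes n.+1 in hK *.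
pose F (u : 'I_n.+1 * 'I_n.+1) : {ffun 'I_(size P) -> bool} :=
  [ffun i : 'I_(size P) => (nth 0%N P i %| u.1%:Z - v.1%:Z)%Z].
suff Finj : {in A &, injective F}.
  apply: leq_trans (leq_card_in F A Finj) _.
  by rewrite card_ffun card_bool card_ord leq_pexp2l.
move=> [s t] [s' t'] /eqP Au /eqP Au' Fuu'.
have ss' : s = s'.
  apply: primes_squarefree_inj => // p pP.
  have bE : (p %| s%:Z - v.1%:Z)%Z = (p %| s'%:Z - v.1%:Z)%Z.
    have iP : (index p P < size P)%N by rewrite index_mem.
    by move/ffunP/(_ (Ordinal iP)): Fuu'; rewrite !ffunE /= nth_index.
  move: (pP); rewrite mem_primes => /and3P[p_pr _ pN].
  have sub w : parabola_point w.1 + parabola_point w.2 = m ->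
      p <> 2%N -> (p %| w.1%:Z - v.1%:Z)%Z \/ (p %| w.1%:Z - v.2%:Z)%Z.
    move=> Aw p2; have [d1 d2] := parabola_sum_eq (etrans Aw (esym Av)).
    by apply: (@parabola_sum_prime p w.1 w.2) => //; apply: (dvdz_trans _ d1) || apply: (dvdz_trans _ d2); rewrite dvdzE.
  case: (boolP (p %| s%:Z - v.1%:Z)%Z) => ps; move: (ps); rewrite bE => ps'.
    have -> : s%:Z - s'%:Z = (s%:Z - v.1%:Z) - (s'%:Z - v.1%:Z) by ring.
    by rewrite rpredB.
  (* Here neither [s] nor [s'] is congruent to [v.1]. Modulo 2 only one other class remains; modulo
     an odd p both must be congruent to [v.2]. *)
  case: (eqVneq p 2%N) => [p2|/eqP p2].
    by move: ps ps'; rewrite p2; lia.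
  have [|{}ps] := sub (s, t) Au p2; first by rewrite (negPf ps).
  have [|{}ps'] := sub (s', t') Au' p2; first by rewrite (negPf ps').
  have -> : s%:Z - s'%:Z = (s%:Z - v.2%:Z) - (s'%:Z - v.2%:Z) by ring.
  by rewrite rpredB.
rewrite -ss' in Au' *; congr (_, _).
(* Once [s] is known, cancelling its point in the group recovers [t]. *)
by have /addrI[] : parabola_point s + parabola_point t
    = parabola_point s + parabola_point t' by rewrite [LHS]Au [RHS]Au'.
Qed.

(** * Complex exponentials and moduli *)

Lemma cisD (R : realType) (a b : R) : cis (a + b) = cis a * cis b.
Proof.
by rewrite /cis cosD sinD; apply/eqP; rewrite eq_complex /= eqxx addrC eqxx.
Qed.

Lemma cis_mulrn (R : realType) (a : R) (k : nat) : cis (a *+ k) = cis a ^+ k.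
Proof.
elim: k => [|k IH]; first by rewrite mulr0n /cis cos0 sin0.
by rewrite mulrS exprS cisD IH.
Qed.

Lemma cis_prim_root (R : realType) (N : nat) :
  (0 < N)%N -> N.-primitive_root (cis (- (2 * pi / N%:R)) : R[i]).
Proof.
move=> N_gt0; have N0 : N%:R != 0 :> R by rewrite pnatr_eq0 -lt0n.
apply/andP; split=> //; apply/forallP => i; rewrite unity_rootE -cis_mulrn.
have -> : - (2 * pi / N%:R) *+ i.+1 = - ((pi * i.+1%:R / N%:R) *+ 2) :> R.
  by rewrite mulr2n -[LHS]mulr_natr; field.
case: (eqVneq i.+1 N) => [->|iN].
  rewrite mulfK // /cis cosN sinN cos2pi sin2pi oppr0.
  by rewrite eqxx.
(* Half-angle argument: cos(2u) = 1 forces sin u = 0, but u = pi(i+1)/N lies strictly between 0 and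
   pi when i+1 < N. *)
have sin_gt0 : 0 < sin (pi * i.+1%:R / N%:R : R).
  apply: sin_gt0_pi; rewrite divr_gt0 ?mulr_gt0 ?pi_gt0 ?ltr0n //=.
  rewrite ltr_pdivrMr ?ltr0n // ltr_pM2l ?pi_gt0 // ltr_nat.
  by rewrite ltn_neqAle iN ltn_ord.
rewrite eqbF_neg eq_complex /= cosN cos_mulr2n; apply/negP => /andP[/eqP c1 _].
have := cos2Dsin2 (pi * i.+1%:R / N%:R : R); nra.
Qed.

Lemma cmodE (R : realType) (z : R[i]) : `|z| = (cmod z)%:C%C.
Proof. by []. Qed.

Lemma cmod_ge0 (R : realType) (z : R[i]) : 0 <= cmod z.
Proof. by rewrite -ler0c -cmodE normr_ge0. Qed.

(** * The restriction bound for the parabola *)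

Lemma fourierE (R : realType) (n : nat) (f : 'I_n.+1 * 'I_n.+1 -> R[i])
    (m : 'I_n.+1 * 'I_n.+1) :
  fourier (N := n.+1) f m =
    n.+1%:R^-1 * \sum_x f x * chi (cis (- (2 * pi / n.+1%:R))) x m.
Proof.
congr (_ * _); apply: eq_bigr => x _; congr (_ * _).
by rewrite -cis_mulrn; congr cis; rewrite -mulr_natr; field; rewrite nat1r pnatr_eq0.
Qed.

(** This is the fourth power of the final bound, up to normalization, so that only integer powers of
    the two sums occur. It is proved in [R[i]] and brought back to [R], every term being the image
    of a real number. *)
Lemma fourier_parabola_L2 (R : realType) (n K : nat)
    (f : 'I_n.+1 * 'I_n.+1 -> R[i]) :
  squarefree n.+1 -> (size (primes n.+1) <= K)%N ->
  (\sum_(t < n.+1) cmod (fourier (N := n.+1) f (parabola_point t)) ^+ 2) ^+ 2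
    <= n.+1%:R^-1 ^+ 2 * 2 ^+ K * (\sum_x cmod (f x) `^ (4 / 3)) ^+ 3.
Proof.
move=> sqf hK; pose a x : R[i] := ((cmod (f x)) `^ (1 / 3))%:C%C.
have hw := @cis_prim_root R n.+1 isT.
have aE x : a x ^+ 3 = `|f x|.
  rewrite -rmorphXn /= -powR_mulrn ?powR_ge0 // -powRrM cmodE.
  by rewrite divfK ?pnatr_eq0 // powRr1 ?cmod_ge0.
have ra x : a x \is Num.real by rewrite complex_real.
have a4 x : a x ^+ 4 = (cmod (f x) `^ (4 / 3))%:C%C.
  rewrite -rmorphXn /= -powR_mulrn ?powR_ge0 // -powRrM.
  by congr (_ `^ _)%:C%C; field.
have := restriction_L43 hw (fun m => card_parabola_sum m sqf hK) ra aE
  (fun t => fourierE f (parabola_point t)).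
under eq_bigr do rewrite cmodE -rmorphXn.
under [X in _ <= _ * X ^+ 3]eq_bigr do rewrite a4.
rewrite -!rmorph_sum natrX -(rmorph_nat (real_complex R) n.+1).
rewrite -(rmorph_nat (real_complex R) 2) -fmorphV -!rmorphXn -!rmorphM.
by rewrite lecR.
Qed.

Lemma big_parabola (R : nmodType) (n : nat) (G : 'I_n.+1 * 'I_n.+1 -> R) :
  \sum_(m in parabola n.+1) G m = \sum_(t < n.+1) G (parabola_point t).
Proof. by rewrite big_imset // => s t _ _ []. Qed.

Lemma card_parabola (n : nat) : #|parabola n.+1| = n.+1.
Proof. by rewrite card_imset ?card_ord // => s t []. Qed.

Lemma restriction_parabola (R : realType) (K N : nat) :
  (0 < N)%N -> squarefree N -> (size (primes N) <= K)%N ->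
  forall f : Zmod N * Zmod N -> R[i],
    ((#|parabola N|%:R)^-1 *
       \sum_(m in parabola N) cmod (fourier f m) ^+ 2) `^ (1 / 2)
    <= 2 `^ (K%:R / 4) * (N%:R)^-1 *
       (\sum_(x : Zmod N * Zmod N) cmod (f x) `^ (4 / 3)) `^ (3 / 4).
Proof.
case: N => // n _ sqf hK f; rewrite card_parabola big_parabola.
have := fourier_parabola_L2 f sqf hK; rewrite /=.
set S := \sum_t _ ^+ 2; set A := \sum_x _ => SA.
have S_ge0 : 0 <= S by apply: sumr_ge0 => t _; exact: sqr_ge0.
have A_ge0 : 0 <= A by apply: sumr_ge0 => x _; exact: powR_ge0.
have N_ge0 : 0 <= n.+1%:R^-1 :> R by rewrite invr_ge0.
(* Every factor is rewritten as a fourth root; monotonicity of the fourth root then leaves [SA]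
   multiplied by N^(-2). *)
have root4 (k : nat) (z : R) : 0 <= z -> z `^ (k%:R / 4) = (z ^+ k) `^ (1 / 4).
  by move=> z_ge0; rewrite -powR_mulrn // -powRrM mulrA mulr1.
have Nroot : n.+1%:R^-1 = (n.+1%:R^-1 ^+ 4) `^ (1 / 4) :> R.
  by rewrite -root4 // divff ?pnatr_eq0 // powRr1.
have -> : 1 / 2 = 2%:R / 4 :> R by field.
rewrite (root4 2) ?mulr_ge0 // (root4 K) // (root4 3) // [X in _ <= _ * X * _]Nroot.
rewrite -!powRM ?mulr_ge0 ?exprn_ge0 //.
apply: ge0_ler_powR; rewrite ?nnegrE ?divr_ge0 ?mulr_ge0 ?exprn_ge0 //.
rewrite exprMn; apply: le_trans (ler_wpM2l _ SA) _; first by rewrite exprn_ge0.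
by rewrite le_eqVlt; apply/orP; left; apply/eqP; ring.
Qed.

(** * Products of two distinct primes *)

(** If d > 1, the square of a prime factor of d would divide pq, whose valuation at any prime is at
    most 1. The value d = 0 is excluded because pq is positive. *)
Lemma squarefree_mul_primes (p q : nat) :
  prime p -> prime q -> p <> q -> squarefree (p * q).
Proof.
move=> p_pr q_pr /eqP pq d dd; have p_gt0 := prime_gt0 p_pr.
have q_gt0 := prime_gt0 q_pr.
apply/eqP; rewrite eqn_leq; apply/andP; split; last first.
  by move: dd; case: d => //; rewrite exp0n // dvd0n muln_eq0 !gtn_eqF.
rewrite leqNgt; apply/negP => d_gt1.
have [r_pr rd] := (pdiv_prime d_gt1, pdiv_dvd d); set r := pdiv d in r_pr rd.
have : (r ^ 2 %| p * q)%N by apply: dvdn_trans dd; rewrite dvdn_exp2r.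
rewrite pfactor_dvdn ?muln_gt0 ?p_gt0 // lognM // !logn_prime //.
by case: eqP => [rp|_]; case: eqP => // rq; rewrite -rp -rq eqxx in pq.
Qed.

Lemma size_primes_mul (p q : nat) :
  prime p -> prime q -> (size (primes (p * q)) <= 2)%N.
Proof.
move=> p_pr q_pr; apply: (uniq_leq_size (s2 := [:: p; q])) => [|r].
  exact: primes_uniq.
by rewrite primesM ?prime_gt0 // !primes_prime // !inE.
Qed.

Unset Implicit Arguments.

Theorem corollary2p3 (R : realType) :
  (forall (K N : nat), (0 < N)%N -> squarefree N -> (size (primes N) <= K)%N ->
     forall f : Zmod N * Zmod N -> R[i],
       ((#|parabola N|%:R)^-1 *
          \sum_(m in parabola N) cmod (fourier f m) ^+ 2) `^ (1 / 2)
       <= 2 `^ (K%:R / 4) * (N%:R)^-1 *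
          (\sum_(x : Zmod N * Zmod N) cmod (f x) `^ (4 / 3)) `^ (3 / 4))
  /\
  (forall p q N : nat, prime p -> prime q -> p <> q -> N = (p * q)%N ->
     forall f : Zmod N * Zmod N -> R[i],
       ((#|parabola N|%:R)^-1 *
          \sum_(m in parabola N) cmod (fourier f m) ^+ 2) `^ (1 / 2)
       <= Num.sqrt 2 * (N%:R)^-1 *
          (\sum_(x : Zmod N * Zmod N) cmod (f x) `^ (4 / 3)) `^ (3 / 4)).
Proof.
split=> [K N N_gt0|p q _ p_pr q_pr pq -> f]; first exact: restriction_parabola.
(* The constant is the case K = 2 of the general bound. *)
have -> : Num.sqrt 2 = 2 `^ (2%:R / 4) :> R.
  by rewrite -powR12_sqrt //; congr (_ `^ _); field.
apply: restriction_parabola; first by rewrite muln_gt0 !prime_gt0.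
  exact: squarefree_mul_primes.
exact: size_primes_mul.
Qed.
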